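(* Let $f:\mathbb{R}^{N}\rightarrow \overline{\mathbb{R}}$ be quasiconvex. Then: (i) $\sup_{U}f=\operatorname{ess\,sup}_{U}f$ for every density open subset $U\subset \mathbb{R}^{N}$. (ii) $\inf_{U}f=\operatorname{ess\,inf}_{U}f$ for every density open subset $U\subset \mathbb{R}^{N}$ if and only if this equality is true when $U=\mathbb{R}^{N}$, i.e. if and only if $\inf_{\mathbb{R}^{N}}f=\operatorname{ess\,inf}_{\mathbb{R}^{N}}f$.
   Context: $\overline{\mathbb{R}}:=[-\infty,\infty]$. A function $f:\mathbb{R}^N\to\overline{\mathbb{R}}$ is quasiconvex if the lower level set $\{x\in\mathbb{R}^N: f(x)<\alpha\}$ is convex for every $\alpha\in\mathbb{R}$ (equivalently, with $\leq$ in place of $<$); such functions are automatically Lebesgue measurable. Measure means Lebesgue measure $\mu_N$ on $\mathbb{R}^N$. A measurable set $E$ has density $1$ at $x$ if $\mu_N(E\cap B(x,r))/\mu_N(B(x,r))\to 1$ as $r\to 0^+$, where $B(x,r)$ is the open euclidean ball with center $x$ and radius $r$. A subset $U\subset\mathbb{R}^N$ is density open if it is empty, or if it is measurable and has density $1$ at each of its points. $\operatorname{ess\,sup}_U f$ and $\operatorname{ess\,inf}_U f$ are the essential supremum and infimum of $f$ on $U$ with respect to $\mu_N$. If $U=\emptyset$, both suprema are $-\infty$ and both infima are $+\infty$. *)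

(* Defs.v *)
From HB Require Import structures.
From mathcomp Require Import all_boot all_order all_algebra.
From mathcomp Require Import all_classical all_reals all_analysis.
Set Implicit Arguments.
Unset Strict Implicit.
Unset Printing Implicit Defensive.
Import Order.TTheory GRing.Theory Num.Theory.
Import numFieldNormedType.Exports.
Local Open Scope classical_set_scope.
Local Open Scope ring_scope.

(* R^N is 'rV[R]_n.+1 with N = n.+1. Lebesgue measure is the Caratheodory
   restriction of the outer measure below, so that "measurable" means Lebesgue
   (not just Borel) measurable. *)
Section lebesgue_outer_measure.
Context {R : realType} {n : nat}.
Implicit Types (A : set 'rV[R]_n.+1) (b : 'rV[R]_n.+1 * 'rV[R]_n.+1).

Definition box b : set 'rV[R]_n.+1 :=
  [set x | forall i, b.1 0 i <= x 0 i <= b.2 0 i].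

Definition box_vol b : R := \prod_i (b.2 0 i - b.1 0 i).

(* The corners are required to be ordered, so that box_vol is the volume. *)
Definition box_cover A : set (nat -> 'rV[R]_n.+1 * 'rV[R]_n.+1) :=
  [set F : nat -> 'rV[R]_n.+1 * 'rV[R]_n.+1 |
    (forall k i, (F k).1 0 i <= (F k).2 0 i) /\ A `<=` \bigcup_k box (F k)].

Definition leb_outer A : \bar R :=
  ereal_inf [set (\sum_(k <oo) (box_vol (F k))%:E)%E | F in box_cover A].

Lemma box_vol_ge0 b : (forall i, b.1 0 i <= b.2 0 i) -> 0 <= box_vol b.
Proof. by move=> bP; apply: prodr_ge0 => i _; rewrite subr_ge0. Qed.

Lemma leb_outer0 : leb_outer set0 = 0%E.
Proof.
apply/eqP; rewrite eq_le; apply/andP; split; last first.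
  apply: le_ereal_inf_tmp => _ [F [F_le _] <-].
  by apply: nneseries_ge0 => k _ _; rewrite lee_fin box_vol_ge0.
apply: ereal_inf_lbound; exists (fun=> (0, 0)); first by split.
by apply: eseries0 => k _ _; rewrite /box_vol big_ord_recl subrr mul0r.
Qed.

Lemma leb_outer_ge0 A : (0 <= leb_outer A)%E.
Proof.
apply: le_ereal_inf_tmp => _ [F [F_le _] <-].
by apply: nneseries_ge0 => k _ _; rewrite lee_fin box_vol_ge0.
Qed.

Lemma le_leb_outer : {homo leb_outer : A B / A `<=` B >-> (A <= B)%E}.
Proof.
move=> A B AB; apply/ereal_inf_le_tmp => _ [F [F_le BF] <-].
by exists F => //; split => //; exact: subset_trans BF.
Qed.

Lemma leb_outer_sigma_subadditive : sigma_subadditive leb_outer.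
Proof.
move=> A; have [[i ioo]|] := pselect (exists i, leb_outer (A i) = +oo%E).
  rewrite (eseries_pinfty _ _ ioo) ?leey// => k _.
  by rewrite -ltNye (lt_le_trans _ (leb_outer_ge0 _)).
rewrite -forallNE => Aoo; apply/lee_addgt0Pr => e e0.
rewrite (le_trans _ (epsilon_trick _ (fun k => leb_outer_ge0 (A k)) (ltW e0)))//.
pose P k F := box_cover (A k) F /\
  (\sum_(j <oo) (box_vol (F j))%:E <=
     leb_outer (A k) + (e / (2 ^ k.+1)%:R)%:E)%E.
have [G PG] : {G & forall k, P k (G k)}.
  apply: (@choice _ _ P) => k.
  have fA : leb_outer (A k) \is a fin_num.
    by rewrite ge0_fin_numE ?leb_outer_ge0// ltey; exact/eqP/Aoo.
  have ek : 0 < e / (2 ^ k.+1)%:R :> R.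
    by rewrite divr_gt0// ltr0n expn_gt0.
  have [_ [F cF <-] lF] := lb_ereal_inf_adherent ek fA.
  by exists F; split => //; exact: ltW.
have G_le k j i : (G k j).1 0 i <= (G k j).2 0 i by have [[+ _] _] := PG k.
pose v (p : nat * nat) : \bar R := (box_vol (G p.1 p.2))%:E.
have v_ge0 p : (0 <= v p)%E by rewrite lee_fin box_vol_ge0.
apply: (@le_trans _ _ (\esum_(p in setT) v p)%E).
  have /card_esym/ppcard_eqP[g] := card_nat2.
  apply: ereal_inf_lbound; exists (fun k => G (g k).1 (g k).2).
    split=> [k i|x [k _ Akx]]; first exact: G_le.
    have [[_ /(_ _ Akx)[j _ Gx]] _] := PG k.
    by exists (g^-1%FUN (k, j)) => //; rewrite invK ?inE.
  rewrite -(esum_pred_image v _ xpredT) ?[fun=> _]set_true//.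
  by rewrite image_eq.
pose J k : set (nat * nat) := [set (k, j) | j in setT].
have -> : [set: nat * nat] = \bigcup_k J k.
  by apply/seteqP; split => // -[a b] _; exists a => //; exists b.
rewrite esum_bigcupT//; last first.
  apply/trivIsetP => a b _ _ /eqP ab; apply/seteqP; split => // p [/=].
  by move=> [j _ <-] [j' _ [/esym/ab]].
rewrite -(image_id [set: nat]) -fun_true esum_pred_image//; last first.
  by move=> k _; exact: esum_ge0.
apply: lee_nneseries => [k _ _|k _]; first exact: esum_ge0.
rewrite /J -fun_true esum_pred_image//; last by move=> a b _ _ [].
by have [_] := PG k.
Qed.

HB.instance Definition _ := isOuterMeasure.Build R 'rV[R]_n.+1 leb_outer
  leb_outer0 leb_outer_ge0 le_leb_outer leb_outer_sigma_subadditive.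

Definition lebN : set (caratheodory_type (@leb_outer)) -> \bar R := leb_outer.

HB.instance Definition _ := isMeasure.Build _ _ _ lebN
  (@caratheodory_measure0 _ _ leb_outer)
  (@caratheodory_measure_ge0 _ _ leb_outer)
  (@caratheodory_measure_sigma_additive _ _ leb_outer).

Definition leb_measurable A : Prop := (@leb_outer).-cara.-measurable A.

End lebesgue_outer_measure.
Arguments lebN R n : clear implicits.

Section density.
Context {R : realType} {n : nat}.
Implicit Types (x : 'rV[R]_n.+1) (E U : set 'rV[R]_n.+1)
  (f : 'rV[R]_n.+1 -> \bar R).

(* The library's [ball] on row vectors is the sup-norm one. *)
Definition eball x (r : R) : set 'rV[R]_n.+1 :=
  [set y | Num.sqrt (\sum_i (y 0 i - x 0 i) ^+ 2) < r].

Definition density1 E x : Prop :=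
  (fun r : R => fine (lebN R n (E `&` eball x r)) /
                fine (lebN R n (eball x r))) @ 0^'+ --> (1 : R).

Definition density_open U : Prop :=
  U = set0 \/ (leb_measurable U /\ forall x, U x -> density1 U x).

Definition quasiconvex f : Prop :=
  forall a : R, convex_set
    ([set x | (f x < a%:E)%E] : set (convex_lmodType 'rV[R]_n.+1)).

(* Essential bounds relative to U: the library's ess_sup and ess_inf are those
   over the whole space. *)
Definition ess_sup_on U f : \bar R :=
  ereal_inf [set y | {ae lebN R n, forall x, U x -> (f x <= y)%E}].

Definition ess_inf_on U f : \bar R :=
  ereal_sup [set y | {ae lebN R n, forall x, U x -> (y <= f x)%E}].

End density.

(* Main.v *)
Require Import Defs.
From HB Require Import structures.
From mathcomp Require Import all_boot all_order all_algebra.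
From mathcomp Require Import all_classical all_reals all_analysis.
From mathcomp Require Import measurable_realfun zify ring lra.
Set Implicit Arguments.
Unset Strict Implicit.
Unset Printing Implicit Defensive.
Import Order.TTheory GRing.Theory Num.Theory.
Import numFieldNormedType.Exports.
Local Open Scope classical_set_scope.
Local Open Scope ring_scope.

(** Both parts are density arguments at a point x of U, for the convex sets
    C = {f < a}, and rest on one estimate ([density1_null_lt]): if U has
    density 1 at x and W meets U in a null set, then W takes up an arbitrarily
    small proportion of the small balls around x. Here W is arbitrary, since it
    is the measurability of U that splits the balls; so the estimate applies to
    convex sets directly. Convexity enters through homotheties
    y |-> x + t (y - x), which multiply outer measure by |t|^N
    ([leb_outer_homothety]).

    (i) Let f < a almost everywhere on U; then f(x) < a. Otherwise x is not in
    C, so C is disjoint from its reflection through x (the midpoint of a point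
    and its reflection is x). The reflection W of U `&` C then meets U in a
    null set, yet it has the same measure as U `&` C in every ball around x,
    that is, almost that of the ball: a contradiction
    ([density1_ae_sublevel]).

    (ii) Let f(x) < a, while f >= a almost everywhere on U. Then C contains x
    and meets U in a null set. If C were not null, it would have positive
    outer measure in some ball around x. As C is convex and contains x, the
    homotheties of ratio t < 1 centred at x map C into C, so the proportion of
    C in smaller balls cannot decrease: a contradiction. Hence C is null
    ([density1_null_sublevel]), so that a is an essential lower bound of f on
    the whole space although inf f < a, which the hypothesis on the whole
    space excludes. Conversely, the whole space is density open, because balls
    have positive and finite measure; positivity comes from
    [box_vol_le_cover], which makes the outer measure of a box its volume. *)

(** * The outer measure of a box is its volume *)

Section box_volume.
Context {R : realType} {n : nat}.
Implicit Types (x : 'rV[R]_n.+1) (b : 'rV[R]_n.+1 * 'rV[R]_n.+1).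

Definition ordered_corners b := forall i, b.1 0 i <= b.2 0 i.

(** The indicator of the box [b], with the first [m] variables integrated
    out. *)
Definition slice b (m : nat) x : R :=
  \prod_(i < n.+1) (if (i < m)%N then b.2 0 i - b.1 0 i
           else \1_(`[b.1 0 i, b.2 0 i]%classic : set R) (x 0 i)).

Lemma slice_ge0 b m x : ordered_corners b -> 0 <= slice b m x.
Proof.
by move=> hb; apply: prodr_ge0 => i _; case: ifP => _; rewrite ?subr_ge0 ?hb.
Qed.

Lemma slice0 b x : slice b 0 x = \1_(box b) x.
Proof.
rewrite /slice indicE; under eq_bigr do rewrite indicE.
case: (asboolP (box b x)) => [bx|nbx].
  by rewrite (mem_set bx) big1// => i _; rewrite mem_set//= in_itv/= bx.
rewrite (memNset nbx).
have [i nbi] : exists i, ~ (b.1 0 i <= x 0 i <= b.2 0 i) by exact/existsNP.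
by rewrite (bigD1 i)//= memNset ?mul0r// => /=; rewrite in_itv.
Qed.

Lemma slice_full b x : slice b n.+1 x = box_vol b.
Proof. by apply: eq_bigr => i _; rewrite ltn_ord. Qed.

(** As a function of its [m]-th variable, [slice b m] is a constant multiple of
    the indicator of an interval. *)
Lemma integral_slice b (m : 'I_n.+1) x : ordered_corners b ->
  (\int[lebesgue_measure]_t
      (slice b m (\row_j if j == m then t else x 0 j))%:E =
   (slice b m.+1 x)%:E)%E /\
  measurable_fun [set: measurableTypeR R]
    (EFin \o fun t => slice b m (\row_j if j == m then t else x 0 j)).
Proof.
move=> hb.
pose c := \prod_(i < n.+1 | i != m) (if (i < m)%N then b.2 0 i - b.1 0 i
           else \1_(`[b.1 0 i, b.2 0 i]%classic : set R) (x 0 i)).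
have c0 : 0 <= c.
  by apply: prodr_ge0 => i _; case: ifP => _; rewrite ?subr_ge0 ?hb.
have sliceE : (fun t => (slice b m (\row_j if j == m then t else x 0 j))%:E) =
    (fun t => c%:E * (\1_(`[b.1 0 m, b.2 0 m]%classic : set R) t)%:E)%E.
  apply/funext => t; rewrite -EFinM; congr EFin.
  rewrite /slice (bigD1 m)//= ltnn mxE eqxx mulrC; congr (_ * _).
  by apply: eq_bigr => i im; rewrite mxE (negbTE im).
have mI : measurable_fun [set: measurableTypeR R]
    (EFin \o (\1_(`[b.1 0 m, b.2 0 m]%classic : set R) : R -> R)).
  apply/measurable_EFinP; exact: measurable_indic.
rewrite /comp sliceE; split; last exact: measurable_funeM.
rewrite ge0_integralZl_EFin//.
rewrite integral_indic// setIT.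
have lenI : lebesgue_measure (`[b.1 0 m, b.2 0 m]%classic : set R) =
    (b.2 0 m - b.1 0 m)%:E.
  rewrite lebesgue_measure_itv/= lte_fin.
  have := hb m; rewrite le_eqVlt => /predU1P[->|->]; last by rewrite EFinB.
  by rewrite ltxx subrr.
have -> : slice b m.+1 x = c * (b.2 0 m - b.1 0 m).
  rewrite /slice (bigD1 m)//= ltnS leqnn mulrC; congr (_ * _).
  apply: eq_bigr => i im.
  by rewrite ltnS leq_eqVlt (inj_eq val_inj) (negbTE im).
by rewrite EFinM; congr (_ * _)%E; exact: lenI.
Qed.

(** A cover of [b] by boxes gives a pointwise inequality between the indicator
    of [b] and the sum of the indicators of the cover. Integrating it one
    coordinate at a time, each time exchanging the integral with the series of
    nonnegative terms, turns the indicators into volumes. *)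
Lemma box_vol_le_cover b F : ordered_corners b -> box_cover (box b) F ->
  ((box_vol b)%:E <= \sum_(k <oo) (box_vol (F k))%:E)%E.
Proof.
move=> hb [hF bF].
have hFk k : ordered_corners (F k) by exact: hF.
suff slice_le m : (m <= n.+1)%N -> forall x,
    ((slice b m x)%:E <= \sum_(k <oo) (slice (F k) m x)%:E)%E.
  have := slice_le _ (leqnn _) 0; rewrite slice_full.
  by under eq_eseriesr do rewrite slice_full.
have s0 m' x k : (0 <= (slice (F k) m' x)%:E)%E by rewrite lee_fin slice_ge0.
elim: m => [_ x|m IH mn x].
  rewrite slice0 indicE; case: (asboolP (box b x)) => [bx|nbx]; last first.
    by rewrite (memNset nbx); exact: nneseries_ge0.
  rewrite (mem_set bx); have [k _ Fkx] := bF _ bx.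
  rewrite (le_trans _ (nneseries_lim_ge k.+1 _))//.
  rewrite big_nat_recr//= slice0 indicE (mem_set Fkx) leeDr//.
  exact: sume_ge0.
have -> : (slice b m.+1 x)%:E = (\int[lebesgue_measure]_t
      (slice b m (\row_j if j == Ordinal mn then t else x 0 j))%:E)%E.
  by rewrite (integral_slice (Ordinal mn) x hb).1.
under eq_eseriesr do rewrite -(integral_slice (Ordinal mn) x (hFk _)).1.
rewrite -integral_nneseries//; last first.
  by move=> k; exact: (integral_slice (Ordinal mn) x (hFk k)).2.
apply: ge0_le_integral => //=.
- by move=> t _; rewrite lee_fin slice_ge0.
- exact: (integral_slice (Ordinal mn) x hb).2.
- apply: ge0_emeasurable_sum => // k _.
  exact: (integral_slice (Ordinal mn) x (hFk k)).2.
- by move=> t _; exact: IH (ltnW mn) _.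
Qed.

Lemma leb_outer_box b : ordered_corners b -> leb_outer (box b) = (box_vol b)%:E.
Proof.
move=> hb; apply/eqP; rewrite eq_le; apply/andP; split; last first.
  by apply: le_ereal_inf_tmp => _ [F bF <-]; exact: box_vol_le_cover.
(* a degenerate box has volume 0, since there is at least one coordinate *)
pose F k : 'rV[R]_n.+1 * 'rV[R]_n.+1 := if k is 0%N then b else (0, 0).
apply: ereal_inf_lbound; exists F.
  by split=> [[|k] i//=|x bx]; exists 0%N.
have F0 k : (0 <= (box_vol (F k))%:E)%E.
  by rewrite lee_fin box_vol_ge0//; case: k.
rewrite nneseries_recl// eseries_cond eseries0 ?adde0//.
by case=> // k _ _; rewrite /box_vol big_ord_recl subrr mul0r.
Qed.

End box_volume.

(** * Homotheties *)

Section homothety.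
Context {R : realType} {n : nat}.
Implicit Types (x y : 'rV[R]_n.+1) (A : set 'rV[R]_n.+1) (t r : R).

Definition homothety x t y : 'rV[R]_n.+1 := x + t *: (y - x).

Lemma homothetyE x t y i :
  homothety x t y 0 i = x 0 i + t * (y 0 i - x 0 i).
Proof. by rewrite !mxE. Qed.

Lemma homothetyK x t : t != 0 -> cancel (homothety x t) (homothety x t^-1).
Proof.
move=> t0 y; rewrite /homothety [x + _ - x]addrC addKr scalerA mulVf//.
by rewrite scale1r addrC subrK.
Qed.

(** Homotheties map boxes to boxes, hence covers to covers; a negative ratio
    exchanges the two corners of a box. *)
Lemma leb_outer_homothety_le x t A : t != 0 ->
  (leb_outer (homothety x t @` A) <= (`|t| ^+ n.+1)%:E * leb_outer A)%E.
Proof.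
move=> t0; have tN0 : 0 < `|t| ^+ n.+1 by rewrite exprn_gt0 ?normr_gt0.
rewrite -lee_pdivrMl//; apply: le_ereal_inf_tmp => _ [F [F_le AF] <-].
rewrite lee_pdivrMl//.
pose h := homothety x t.
pose G k := if 0 < t then (h (F k).1, h (F k).2) else (h (F k).2, h (F k).1).
have volG k : box_vol (G k) = `|t| ^+ n.+1 * box_vol (F k).
  rewrite /box_vol -[X in _ ^+ X]card_ord -prodr_const -big_split/=.
  apply: eq_bigr => i _; rewrite /G; case: ltP => ht; rewrite !homothetyE.
    by rewrite gtr0_norm//; ring.
  by rewrite ler0_norm//; ring.
rewrite -nneseriesZl; last by move=> k _; rewrite lee_fin box_vol_ge0.
under eq_eseriesr do rewrite -EFinM -volG.
apply: ereal_inf_lbound; exists G => //; split.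
  move=> k i; have := F_le k i; rewrite /G.
  case: ltP => ht; rewrite !homothetyE.
    by move=> Fki; rewrite lerD2l ler_pM2l// lerB.
  by move=> Fki; rewrite lerD2l ler_wnM2l// lerB.
move=> _ [y Ay <-]; have [k _ Fky] := AF _ Ay; exists k => // i.
have /andP[F1y yF2] := Fky i; rewrite /G; case: ltP => ht; rewrite !homothetyE.
  by rewrite !lerD2l !ler_pM2l// !lerB.
by rewrite !lerD2l !ler_wnM2l// !lerB.
Qed.

Lemma leb_outer_homothety x t A : t != 0 ->
  leb_outer (homothety x t @` A) = ((`|t| ^+ n.+1)%:E * leb_outer A)%E.
Proof.
move=> t0; apply/eqP; rewrite eq_le leb_outer_homothety_le//=.
rewrite -lee_pdivlMl ?exprn_gt0 ?normr_gt0// -exprVn -normfV.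
have htA : homothety x t^-1 @` (homothety x t @` A) = A.
  rewrite image_comp (_ : _ \o _ = id) ?image_id//.
  by apply/funext => y /=; exact: homothetyK.
by rewrite -[X in (leb_outer X <= _)%E]htA
  leb_outer_homothety_le ?invr_eq0.
Qed.

Lemma eball_homothety x t r y : t != 0 ->
  eball x (`|t| * r) (homothety x t y) <-> eball x r y.
Proof.
move=> t0; rewrite /eball/=.
under eq_bigr do rewrite homothetyE addrC addKr exprMn.
by rewrite -mulr_sumr sqrtrM ?sqr_ge0// sqrtr_sqr ltr_pM2l ?normr_gt0.
Qed.

Lemma homothety_setI_eball x t r A : t != 0 ->
  homothety x t @` A `&` eball x (`|t| * r) =
  homothety x t @` (A `&` eball x r).
Proof.
move=> t0; apply/seteqP; split.
  by move=> _ [[y Ay <-] /(eball_homothety _ _ _ t0) By]; exists y.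
move=> _ [y [Ay By] <-]; split; first by exists y.
exact/eball_homothety.
Qed.

End homothety.

(** * Euclidean balls and null sets *)

Section eball_measure.
Context {R : realType} {n : nat}.
Implicit Types (x y : 'rV[R]_n.+1) (A B : set 'rV[R]_n.+1) (r : R).

Lemma leb_outer_null_sub A B :
  A `<=` B -> leb_outer B = 0%E -> leb_outer A = 0%E.
Proof.
move=> AB B0; apply/eqP; rewrite eq_le leb_outer_ge0 andbT -B0.
exact: le_leb_outer.
Qed.

Lemma eball_sub_box x r :
  eball x r `<=` box (x - const_mx `|r|, x + const_mx `|r|).
Proof.
move=> y; rewrite /eball/= => yr i; rewrite !mxE.
have : `|y 0 i - x 0 i| <= `|r|.
  rewrite -[leLHS]sqrtr_sqr (le_trans _ (ltW (lt_le_trans yr (ler_norm r))))//.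
  rewrite ler_wsqrtr// (bigD1 i)//= lerDl sumr_ge0// => j _; exact: sqr_ge0.
by rewrite ler_norml => /andP[? ?]; apply/andP; split; lra.
Qed.

Lemma leb_outer_eball_fin x r : leb_outer (eball x r) \is a fin_num.
Proof.
rewrite ge0_fin_numE ?leb_outer_ge0//.
rewrite (le_lt_trans (le_leb_outer (@eball_sub_box x r)))//.
rewrite leb_outer_box ?ltry//.
by move=> i; rewrite !mxE; have := normr_ge0 r; lra.
Qed.

Lemma leb_outer_setI_eball_fin A x r :
  leb_outer (A `&` eball x r) \is a fin_num.
Proof.
rewrite ge0_fin_numE ?leb_outer_ge0//.
rewrite (le_lt_trans (le_leb_outer (@subIsetr _ A (eball x r))))//.
by rewrite -ge0_fin_numE ?leb_outer_ge0// leb_outer_eball_fin.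
Qed.

Lemma leb_outer_eball_gt0 x r : 0 < r -> (0 < leb_outer (eball x r))%E.
Proof.
(* The half-side s of the cube satisfies N s^2 < (N + 1)^2 s^2 = r^2. *)
move=> r0; pose s := r / n.+2%:R.
have s0 : 0 < s by rewrite divr_gt0.
pose b := (x - const_mx s, x + const_mx s).
have bB : box b `<=` eball x r.
  move=> y by_; rewrite /eball/= -(ger0_norm (ltW r0)) -sqrtr_sqr.
  rewrite ltr_sqrt ?exprn_gt0//.
  apply: (@le_lt_trans _ _ (\sum_(i < n.+1) s ^+ 2)).
    apply: ler_sum => i _; have := by_ i; rewrite !mxE => /andP[? ?].
    rewrite -(real_normK (num_real (y 0 i - x 0 i))).
    rewrite lerXn2r ?nnegrE ?(ltW s0)// ler_norml.
    by apply/andP; split; lra.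
  rewrite sumr_const card_ord -mulr_natl.
  have -> : r ^+ 2 = n.+2%:R ^+ 2 * s ^+ 2 by rewrite -exprMn mulrC divfK.
  rewrite ltr_pM2r ?exprn_gt0// -natrX ltr_nat; lia.
rewrite (lt_le_trans _ (le_leb_outer bB))// leb_outer_box.
  by rewrite lte_fin prodr_gt0// => i _; rewrite !mxE; lra.
by move=> i; rewrite !mxE; lra.
Qed.

Lemma fine_leb_outer_eball_gt0 x r :
  0 < r -> 0 < fine (leb_outer (eball x r)).
Proof.
move=> r0; rewrite fine_gt0// leb_outer_eball_gt0//=.
by rewrite -ge0_fin_numE ?leb_outer_ge0// leb_outer_eball_fin.
Qed.

Lemma bigcup_eball x : \bigcup_k eball x k.+1%:R = setT.
Proof.
rewrite -subTset => y _.
exists (Num.truncn (Num.sqrt (\sum_i (y 0 i - x 0 i) ^+ 2))) => //.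
by rewrite /eball/= truncnS_gt.
Qed.

Lemma leb_measurable_null A : leb_outer A = 0%E -> leb_measurable A.
Proof.
move=> A0; apply: le_caratheodory_measurable => X.
rewrite -[leRHS]add0e -A0; apply: leeD; first exact: le_leb_outer.
exact: le_leb_outer.
Qed.

Lemma ae_lebNP (P : 'rV[R]_n.+1 -> Prop) :
  {ae lebN R n, forall x, P x} <-> leb_outer [set x | ~ P x] = 0%E.
Proof.
split=> [[N [_ N0 PN]]|P0].
  exact: leb_outer_null_sub PN N0.
exists [set x | ~ P x]; split=> //.
exact: leb_measurable_null.
Qed.

End eball_measure.

(** * Density points *)

Section density_points.
Context {R : realType} {n : nat}.
Implicit Types (x y : 'rV[R]_n.+1) (U W : set 'rV[R]_n.+1) (e r : R).

(** U being measurable, the part of a small ball B outside U has measure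
    |B| - |U `&` B|, at most e |B|; up to a null set, W `&` B lies in that
    part. *)
Lemma density1_null_lt U W x e : leb_measurable U -> density1 U x ->
  leb_outer (U `&` W) = 0%E -> 0 < e ->
  \forall r \near (0:R)^'+, (leb_outer (W `&` eball x r) <
    (e * fine (leb_outer (eball x r)))%:E)%E.
Proof.
move=> mU U1 UW0 e0.
have U1e : \forall r \near (0:R)^'+,
    1 - e < fine (leb_outer (U `&` eball x r)) / fine (leb_outer (eball x r)).
  by apply: (cvgr_gt _ U1); lra.
near=> r.
have r0 : 0 < r by near: r; exact: nbhs_right_gt.
have : 1 - e <
    fine (leb_outer (U `&` eball x r)) / fine (leb_outer (eball x r)).
  by near: r.
set B := eball x r => ratio.
have B_fin : leb_outer B \is a fin_num := leb_outer_eball_fin x r.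
have BU_fin D : leb_outer (B `&` D) \is a fin_num.
  by rewrite setIC leb_outer_setI_eball_fin.
have B0 : 0 < fine (leb_outer B) by exact: fine_leb_outer_eball_gt0.
move: ratio; rewrite ltr_pdivlMr// setIC => ratio.
have split_B : fine (leb_outer B) =
    fine (leb_outer (B `&` U)) + fine (leb_outer (B `&` ~` U)).
  by rewrite -fineD//; congr fine; exact: mU.
have WB : (leb_outer (W `&` B) <= leb_outer (B `&` ~` U))%E.
  rewrite -[leRHS]add0e -UW0; apply: le_trans (outer_measureU2 _ _ _).
  apply: le_leb_outer => y [Wy By].
  by have [Uy|Uy] := pselect (U y); [left|right].
rewrite (le_lt_trans WB)// -[X in (X < _)%E]fineK// lte_fin; lra.
Unshelve. all: by end_near. Qed.

Lemma density1_setT x : density1 [set: 'rV[R]_n.+1] x.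
Proof.
apply: cvg_near_cst; near=> r.
have r0 : 0 < r by near: r; exact: nbhs_right_gt.
by rewrite setTI divff// gt_eqF// fine_leb_outer_eball_gt0.
Unshelve. all: by end_near. Qed.

Lemma density_open_setT : density_open [set: 'rV[R]_n.+1].
Proof. by right; split=> [|x _]; [exact: measurableT|exact: density1_setT]. Qed.

End density_points.

(** * Sublevel sets of quasiconvex functions at a density point *)

Section sublevel_density.
Context {R : realType} {n : nat}.
Implicit Types (x y z : 'rV[R]_n.+1) (U : set 'rV[R]_n.+1) (a t : R)
  (f : 'rV[R]_n.+1 -> \bar R).

Definition sublevel f (a : R) := [set x | (f x < a%:E)%E].

Lemma quasiconvex_homothety f a y z t : quasiconvex f -> 0 <= t <= 1 ->
  sublevel f a y -> sublevel f a z -> sublevel f a (homothety z t y).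
Proof.
move=> qf /andP[t0 t1] fy fz.
have := qf a y z (Itv01 t0 t1) (mem_set fy) (mem_set fz).
move/set_mem; rewrite /sublevel/=; congr ((f _ < _)%E).
rewrite /conv/= /homothety scalerBl scale1r scalerBr.
by rewrite addrC -addrA [- _ + _]addrC.
Qed.

(** If C = [sublevel f a] missed x, then the reflection W of U `&` C through x
    would miss C, hence almost all of U, and would occupy less than half of a
    small ball B around x. So would the complement of U. But W occupies as much
    of B as U `&` C does, that is, as much as U does. *)
Lemma density1_ae_sublevel f a U x : quasiconvex f ->
  leb_measurable U -> density1 U x ->
  leb_outer (U `\` sublevel f a) = 0%E -> sublevel f a x.
Proof.
move=> qf mU U1 UC0; apply: contrapT => nCx.
set C := sublevel f a in UC0 nCx.
have N10 : -1 != 0 :> R by rewrite oppr_eq0 oner_eq0.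
pose W := homothety x (-1) @` (U `&` C).
have UW0 : leb_outer (U `&` W) = 0%E.
  apply: leb_outer_null_sub UC0 => z [Uz [y [_ Cy] yz]].
  split=> // Cz; apply: nCx.
  (* x is the midpoint of y and of its reflection z *)
  have -> : x = homothety z 2^-1 y.
    by rewrite -yz; apply/rowP => i; rewrite !homothetyE; field.
  by apply: quasiconvex_homothety => //; lra.
have h0 : 0 < 2^-1 :> R by rewrite invr_gt0.
have UUC0 : leb_outer (U `&` ~` U) = 0%E by rewrite setICr leb_outer0.
have : \forall r \near (0:R)^'+, False.
  near=> r.
  have : (leb_outer (W `&` eball x r) <
      (2^-1 * fine (leb_outer (eball x r)))%:E)%E.
    by near: r; exact: density1_null_lt UW0 h0.
  have : (leb_outer (~` U `&` eball x r) <
      (2^-1 * fine (leb_outer (eball x r)))%:E)%E.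
    by near: r; exact: density1_null_lt UUC0 h0.
  set B := eball x r => UCB WB.
  have WBE : leb_outer (W `&` B) = leb_outer ((U `&` C) `&` B).
    rewrite /B -[X in W `&` eball x X]mul1r -(normrN1 R).
    rewrite homothety_setI_eball// leb_outer_homothety//.
    by rewrite normrN1 expr1n mul1e.
  have : (leb_outer B <= leb_outer (W `&` B) + leb_outer (~` U `&` B))%E.
    rewrite WBE (mU B) [~` U `&` B]setIC leeD2r//.
    rewrite -[leRHS]adde0 -UC0; apply: le_trans (outer_measureU2 _ _ _).
    apply: le_leb_outer => y [By Uy].
    by have [Cy|Cy] := pselect (C y); [left|right].
  apply/negP; rewrite -ltNge (lt_le_trans (lteD WB UCB))//.
  rewrite -EFinD -mulrDl -[2^-1]mul1r -splitr mul1r fineK//.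
  exact: leb_outer_eball_fin.
by move/filter_ex => [].
Unshelve. all: by end_near. Qed.

(** If C = [sublevel f a] had positive outer measure in the ball of radius s
    around x, let c be its proportion there. For r < s the homothety of ratio
    r / s centred at x maps the part of C in the larger ball into the part of C
    in the ball of radius r, by convexity; so C fills at least the same
    proportion c of all small balls, although C meets U in a null set. *)
Lemma density1_null_sublevel f a U x : quasiconvex f ->
  leb_measurable U -> density1 U x -> sublevel f a x ->
  leb_outer (U `&` sublevel f a) = 0%E -> leb_outer (sublevel f a) = 0%E.
Proof.
move=> qf mU U1 Cx UC0; set C := sublevel f a in Cx UC0 *.
suff C0 k : leb_outer (C `&` eball x k.+1%:R) = 0%E.
  apply/eqP; rewrite eq_le leb_outer_ge0 andbT.
  rewrite -[C]setIT -(bigcup_eball x) setI_bigcupr.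
  rewrite (le_trans (leb_outer_sigma_subadditive _))//.
  by rewrite eseries0.
apply: contrapT => /eqP Ck0; set s : R := k.+1%:R in Ck0.
have s0 : 0 < s by rewrite ltr0n.
have Ck_fin := leb_outer_setI_eball_fin C x s.
have Cs0 : 0 < fine (leb_outer (C `&` eball x s)).
  rewrite fine_gt0// lt_neqAle eq_sym Ck0 leb_outer_ge0/=.
  by rewrite -ge0_fin_numE ?leb_outer_ge0.
have Bs0 : 0 < fine (leb_outer (eball x s)) by exact: fine_leb_outer_eball_gt0.
pose c := fine (leb_outer (C `&` eball x s)) / fine (leb_outer (eball x s)).
have c0 : 0 < c by exact: divr_gt0.
have : \forall r \near (0:R)^'+, False.
  near=> r.
  have r0 : 0 < r by near: r; exact: nbhs_right_gt.
  have rs : r < s by near: r; exact: nbhs_right_lt.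
  have : (leb_outer (C `&` eball x r) <
      (c * fine (leb_outer (eball x r)))%:E)%E.
    by near: r; exact: density1_null_lt UC0 c0.
  pose t := r / s.
  have t0 : 0 < t by exact: divr_gt0.
  have t1 : t <= 1 by rewrite ler_pdivrMr// mul1r ltW.
  have rE : r = `|t| * s by rewrite gtr0_norm// divfK// gt_eqF.
  apply/negP; rewrite -leNgt.
  have -> : leb_outer (eball x r) =
      ((`|t| ^+ n.+1)%:E * leb_outer (eball x s))%E.
    rewrite -(@leb_outer_homothety _ _ x) ?gt_eqF//.
    rewrite -[eball x s]setTI -homothety_setI_eball ?gt_eqF// -rE.
    congr leb_outer; rewrite -[LHS]setTI; congr (_ `&` _).
    apply/esym; rewrite -subTset => y _.
    exists (homothety x t^-1 y) => //.
    have t10 : t^-1 != 0 by rewrite invr_eq0 gt_eqF.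
    by have := homothetyK x t10 y; rewrite invrK.
  rewrite fineM ?leb_outer_eball_fin//= mulrCA divfK ?gt_eqF//.
  rewrite EFinM fineK// -(@leb_outer_homothety _ _ x) ?gt_eqF//.
  rewrite -homothety_setI_eball ?gt_eqF// -rE; apply: le_leb_outer.
  move=> _ [[y Cy <-] By]; split=> //.
  by apply: quasiconvex_homothety => //; rewrite ltW.
by move/filter_ex => [].
Unshelve. all: by end_near. Qed.

End sublevel_density.

(** * Essential bounds on density open sets *)

Lemma ereal_lt_real_le (R : realType) (y z : \bar R) : (y < z)%E ->
  exists a : R, (y < a%:E)%E /\ (a%:E <= z)%E.
Proof.
case: y z => [r| |] [s| |]//= rs.
- by exists s.
- by exists (r + 1); rewrite leey lte_fin ltrDl.
- by exists s; rewrite ltNyr.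
- by exists 0; rewrite ltNyr leey.
Qed.

Theorem theorem3 (R : realType) (n : nat) (f : 'rV[R]_n.+1 -> \bar R)
    (qf : quasiconvex f) :
  (forall U : set 'rV[R]_n.+1, density_open U ->
     ereal_sup [set f x | x in U] = ess_sup_on U f) /\
  ((forall U : set 'rV[R]_n.+1, density_open U ->
      ereal_inf [set f x | x in U] = ess_inf_on U f) <->
   ereal_inf [set f x | x in [set: 'rV[R]_n.+1]] =
     ess_inf_on [set: 'rV[R]_n.+1] f).
Proof.
split=> [U oU|]; last split=> [|infT U oU].
- apply/eqP; rewrite eq_le; apply/andP; split; last first.
    apply: ereal_inf_lbound; apply/ae_lebNP.
    rewrite [X in leb_outer X](_ : _ = set0) ?leb_outer0//.
    rewrite -subset0 => x /=; apply => Ux.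
    by apply: ereal_sup_ubound; exists x.
  apply: le_ereal_inf_tmp => y /ae_lebNP fy; apply: ge_ereal_sup => _ [x Ux <-].
  rewrite leNgt; apply/negP => /ereal_lt_real_le[a [ya afx]].
  case: oU => [U0|[mU /(_ _ Ux) U1]]; first by rewrite U0 in Ux.
  suff : sublevel f a x by rewrite /sublevel/= ltNge afx.
  apply: (density1_ae_sublevel qf mU U1).
  apply: leb_outer_null_sub fy => z [Uz nCz] /= fyz.
  by apply: nCz; exact: le_lt_trans (fyz Uz) ya.
- by apply; exact: density_open_setT.
- apply/eqP; rewrite eq_le; apply/andP; split.
    apply: ereal_sup_ubound; apply/ae_lebNP.
    rewrite [X in leb_outer X](_ : _ = set0) ?leb_outer0//.
    rewrite -subset0 => x /=; apply => Ux.
    by apply: ereal_inf_lbound; exists x.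
  apply: ge_ereal_sup => y /ae_lebNP fy; apply: le_ereal_inf_tmp => _ [x Ux <-].
  rewrite leNgt; apply/negP => /ereal_lt_real_le[a [fxa ay]].
  case: oU => [U0|[mU /(_ _ Ux) U1]]; first by rewrite U0 in Ux.
  have UC0 : leb_outer (U `&` sublevel f a) = 0%E.
    apply: leb_outer_null_sub fy => z [Uz Cz] /= /(_ Uz) yfz.
    by have := lt_le_trans Cz (le_trans ay yfz); rewrite ltxx.
  have C0 := density1_null_sublevel qf mU U1 fxa UC0.
  suff : (a%:E <= f x)%E by rewrite leNgt fxa.
  apply: (@le_trans _ _ (ereal_inf [set f x | x in [set: 'rV[R]_n.+1]])).
    rewrite infT; apply: ereal_sup_ubound; apply/ae_lebNP.
    apply: leb_outer_null_sub C0 => z /= naf.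
    rewrite /sublevel/= ltNge; apply/negP => afz.
    exact: naf.
  by apply: ereal_inf_lbound; exists x.
Qed.
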